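(* Let $d$ be a nonnegative integer and let $G$ be a $d$-regular graph. Then $$\chi_2(G)\leq \chi(G)+\lceil e\log(d^2+1)+e\rceil .$$
   Context: Graphs are finite and simple. $\chi(G)$ is the chromatic number of $G$. For a positive integer $r$, an $r$-dynamic $k$-coloring of $G$ is a proper vertex coloring of $G$ with $k$ colors such that, for every vertex $v$, at least $\min\{r,\deg(v)\}$ different colors appear on the neighbors of $v$. The $r$-dynamic chromatic number $\chi_r(G)$ is the smallest $k$ such that $G$ has an $r$-dynamic $k$-coloring; $\chi_2(G)$ (the case $r=2$) is called the dynamic chromatic number. $\log$ is the natural logarithm and $e$ is its base. *)

(* Defs.v *)
From mathcomp Require Import all_boot.

Set Implicit Arguments.
Unset Strict Implicit.
Unset Printing Implicit Defensive.

Record sgraph := SGraph {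
  vertex :> finType;
  adj : rel vertex;
  adj_sym : symmetric adj;
  adj_irr : irreflexive adj }.

Definition nbh (G : sgraph) (v : G) : {set G} := [set w | adj v w].

Definition deg (G : sgraph) (v : G) : nat := #|nbh v|.

Definition regular_graph (d : nat) (G : sgraph) : Prop := forall v : G, deg v = d.

Definition proper_coloring (G : sgraph) (k : nat) (c : {ffun G -> 'I_k}) : bool :=
  [forall v, forall w, adj v w ==> (c v != c w)].

Definition dynamic_coloring (r : nat) (G : sgraph) (k : nat)
    (c : {ffun G -> 'I_k}) : bool :=
  proper_coloring c &&
  [forall v, minn r (deg v) <= #|[set c w | w in nbh v]|].

(* As usual, a k-coloring need not use all k colors. *)
Definition colorable (G : sgraph) (k : nat) : bool :=
  [exists c : {ffun G -> 'I_k}, proper_coloring c].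

Definition dynamic_colorable (r : nat) (G : sgraph) (k : nat) : bool :=
  [exists c : {ffun G -> 'I_k}, dynamic_coloring r c].

Lemma dynamic_colorable_card (r : nat) (G : sgraph) :
  dynamic_colorable r G #|G|.
Proof.
apply/existsP; exists [ffun v => enum_rank v].
have inj : injective [ffun v : G => enum_rank v].
  by move=> v w; rewrite !ffunE => /enum_rank_inj.
apply/andP; split.
  apply/forallP => v; apply/forallP => w; apply/implyP => vw.
  rewrite (inj_eq inj); apply/eqP => v_w.
  by rewrite v_w adj_irr in vw.
by apply/forallP => v; rewrite card_imset // geq_minr.
Qed.

Lemma ex_dynamic_colorable (r : nat) (G : sgraph) :
  exists k, dynamic_colorable r G k.
Proof. by exists #|G|; apply: dynamic_colorable_card. Qed.

Lemma ex_colorable (G : sgraph) : exists k, colorable G k.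
Proof.
exists #|G|; have /existsP[c /andP[cP _]] := dynamic_colorable_card 1 G.
by apply/existsP; exists c.
Qed.

Definition chromatic_number (G : sgraph) : nat := ex_minn (ex_colorable G).

Definition dynamic_chromatic_number (r : nat) (G : sgraph) : nat :=
  ex_minn (ex_dynamic_colorable r G).

(* Main.v *)
(* Put k = ceil(e * ln(d^2 + 1) + e).  Given an optimal proper coloring, it is
   enough to recolor with k new colors a set X such that every neighbourhood
   N(v) meets X and its complement, and every v in X has fewer than k
   neighbours in X: then X can be colored greedily, and every N(v) sees an old
   and a new color.

   For d >= 9 such an X is found with the local lemma, each vertex being put in
   X independently with probability p.  The bad event at v depends only on
   X within N[v], and N[u] meets N[v] for at most d^2 vertices u <> v.
   If k <= d, take p = k / (e * d), so that the mean of |N(v) & X| is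
   m = k / e >= 1 + ln(d^2 + 1).  Both (1 - p)^d and, by Chernoff,
   Pr(|N(v) & X| >= k) are at most exp(-m); the second only counts when
   v is in X, and the resulting extra term p * exp(-m) fits in the gap between
   (1 - p)^d and exp(-m).  If k > d, the degree condition is void and p = 1/2
   works.

   For 2 <= d <= 8, a greedy coloring with 2 * d + 1 colors is already dynamic,
   and 2 * d + 1 <= 2 + k. *)
Require Import Defs.
From mathcomp Require Import all_boot all_order all_algebra.
From mathcomp Require Import all_classical all_reals all_analysis.
From mathcomp Require Import fintype finset zify ring lra.
Import Order.TTheory GRing.Theory Num.Theory.
Local Open Scope ring_scope.

Set Implicit Arguments.
Unset Strict Implicit.
Unset Printing Implicit Defensive.

(** * Lopsided Lovász local lemma for weighted sums *)

Definition avoids (Om I : finType) (A : I -> pred Om) (S : {set I}) : pred Om :=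
  fun o => [forall (i | i \in S), ~~ A i o].

Lemma avoidsU1 (Om I : finType) (A : I -> pred Om) (S : {set I}) i o :
  avoids A (i |: S) o = ~~ A i o && avoids A S o.
Proof.
apply/forall_inP/andP => [h|[hi /forall_inP hS] j].
  split; first by apply: h; rewrite setU11.
  by apply/forall_inP => j jS; apply: h; rewrite setU1r.
by rewrite !inE => /orP[/eqP -> //|]; apply: hS.
Qed.

(** When events are added to [S0] one at a time, each is avoided with conditional probability at
    least [1 - x]. Working with products instead of quotients avoids conditioning on null events. *)
Lemma peel_avoids (R : realDomainType) (Om I : finType) (w : Om -> R)
    (A : I -> pred Om) (x : R) (n : nat) :
  x <= 1 ->
  (forall (i : I) (S : {set I}), (#|S| < n)%N -> i \notin S ->
     \sum_(o | A i o && avoids A S o) w o <= x * \sum_(o | avoids A S o) w o) ->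
  forall S0 S : {set I}, S0 \subset S -> (#|S| <= n)%N ->
    (1 - x) ^+ #|S :\: S0| * \sum_(o | avoids A S0 o) w o
    <= \sum_(o | avoids A S o) w o.
Proof.
move=> x1 hx S0 S.
move: {2}#|S :\: S0| (erefl #|S :\: S0|) => m.
elim: m S => [|m IH] S hm sub hn.
  rewrite hm expr0 mul1r; have -> // : S = S0.
  by apply/eqP; rewrite eqEsubset sub andbT -setD_eq0 -cards_eq0 hm.
have /card_gt0P[j] : (0 < #|S :\: S0|)%N by rewrite hm.
rewrite inE => /andP[jS0 jS].
have cS : #|S| = (#|S :\ j|).+1 by rewrite (cardsD1 j) jS.
have cD : #|(S :\ j) :\: S0| = m.
  apply: succn_inj; rewrite -hm (cardsD1 j (S :\: S0)) inE jS jS0 add1n.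
  by rewrite !setDDl setUC.
have sub' : S0 \subset S :\ j.
  by apply/subsetP => i iS0; rewrite !inE (subsetP sub) // andbT;
     apply: contraNneq jS0 => <-.
have := IH _ cD sub'; rewrite -ltnS -cS => /(_ (leqW hn)); rewrite cD hm => {}IH.
have hj : \sum_(o | A j o && avoids A (S :\ j) o) w o
    <= x * \sum_(o | avoids A (S :\ j) o) w o.
  by apply: hx; rewrite -?cS ?setD11.
have split_sum : \sum_(o | avoids A (S :\ j) o) w o =
    \sum_(o | A j o && avoids A (S :\ j) o) w o + \sum_(o | avoids A S o) w o.
  rewrite (bigID (A j)) /=; congr (_ + _); apply: eq_bigl => o; first exact: andbC.
  by rewrite -{2}(setD1K jS) avoidsU1 andbC.
have := ler_wpM2l (_ : 0 <= 1 - x) IH.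
rewrite subr_ge0 => /(_ x1); rewrite mulrA -exprS => /le_trans; apply.
lra.
Qed.

(* The lopsided form: instead of independence, only the one-sided
   correlation inequality that the induction consumes. *)
Lemma lopsided_local_lemma (R : realDomainType) (Om I : finType) (w : Om -> R)
    (A : I -> pred Om) (nb : I -> {set I}) (D : nat) (x q : R) :
  (forall o, 0 <= w o) -> 0 < \sum_o w o -> 0 <= x < 1 ->
  q <= x * (1 - x) ^+ D -> (forall i, (#|nb i :\ i| <= D)%N) ->
  (forall i (S : {set I}), i \notin S -> [disjoint S & nb i] ->
     \sum_(o | A i o && avoids A S o) w o <= q * \sum_(o | avoids A S o) w o) ->
  exists o, forall i, ~~ A i o.
Proof.
move=> w0 wpos /andP[x0 x1] hq hD hA.
have hx n : forall i (S : {set I}), (#|S| < n)%N -> i \notin S ->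
    \sum_(o | A i o && avoids A S o) w o <= x * \sum_(o | avoids A S o) w o.
  elim: n => // n IH i S; rewrite ltnS => hS iS.
  (* The events of [S] in [nb i], at most [D] of them since [i] is not in [S], are peeled off. What
     remains satisfies the correlation hypothesis. *)
  have := peel_avoids (ltW x1) IH (subsetDl S (nb i)) hS.
  have -> : S :\: (S :\: nb i) = S :&: nb i by rewrite setDDr setDv set0U.
  move=> peel.
  have : \sum_(o | A i o && avoids A (S :\: nb i) o) w o
      <= q * \sum_(o | avoids A (S :\: nb i) o) w o.
    apply: hA; first by rewrite inE negb_and iS orbT.
    by rewrite -setI_eq0 setIDAC setDIl setDv setI0.
  set a := \sum_(o | avoids A (S :\: nb i) o) w o in peel *; move=> haq.
  have a0 : 0 <= a by apply: sumr_ge0.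
  apply: le_trans (_ : q * a <= _).
    apply: le_trans haq; rewrite [leRHS](bigID (avoids A S)) /=.
    rewrite -[leLHS]addr0 lerD ?sumr_ge0 // le_eqVlt; apply/orP; left; apply/eqP.
    apply: eq_bigl => o; case: (A i o) => //=.
    case hSo: (avoids A S o); rewrite ?andbF // andbT.
    apply/esym/forall_inP => j; rewrite inE => /andP[_ jS].
    by move/forall_inP: hSo; apply.
  apply: le_trans (ler_wpM2r a0 hq) _; rewrite -mulrA ler_wpM2l //.
  apply: le_trans peel; apply: ler_wpM2r => //.
  apply: ler_wiXn2l; rewrite ?subr_ge0 ?(ltW x1) //; first lra.
  apply: leq_trans (hD i); apply: subset_leq_card; apply/subsetP => j.
  rewrite !inE => /andP[jS ->]; rewrite andbT.
  by apply: contraNneq iS => <-.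
have [Z ho|none] := pickP (avoids A [set: I]).
  by exists Z => i; move/forall_inP: ho; apply.
(* If no outcome avoided all events, peeling down to the empty set would bound a positive multiple
   of the total weight by 0. *)
have := peel_avoids (ltW x1) (hx #|I|) (sub0set [set: I]); rewrite cardsT leqnn.
move=> /(_ isT); rewrite [X in _ <= X]big_pred0 // leNgt mulr_gt0 //.
  by rewrite exprn_gt0 // subr_gt0.
rewrite (eq_bigl xpredT) // => o; apply/forall_inP => i; by rewrite inE.
Qed.

(** * Random subsets with independent memberships *)

Definition bernoulli_weight (R : pzRingType) (T : finType) (p : R) (X : {set T}) : R :=
  \prod_i (if i \in X then p else 1 - p).

(** Expectation of a product of factors, each depending on one membership: expand the right side by
    distributivity. *)
Lemma bernoulli_sum_prod (R : comPzRingType) (T : finType) (p : R) (F G : T -> R) :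
  \sum_(X : {set T}) bernoulli_weight p X * \prod_i (if i \in X then F i else G i) =
  \prod_i (p * F i + (1 - p) * G i).
Proof.
rewrite bigA_distr; apply: eq_bigr => X _; rewrite -big_split /=.
by apply: eq_bigr => i _; case: ifP.
Qed.

Lemma bernoulli_sum1 (R : comPzRingType) (T : finType) (p : R) :
  \sum_(X : {set T}) bernoulli_weight p X = 1.
Proof.
transitivity (\prod_(i : T) (p * 1 + (1 - p) * 1)).
  rewrite -bernoulli_sum_prod; apply: eq_bigr => X _.
  by rewrite big1 ?mulr1 // => i _; case: ifP.
by rewrite big1 // => i _; rewrite !mulr1 addrC subrK.
Qed.

(* Exchanging the parts outside U of two independent samples preserves the
   product weight. *)
Lemma bernoulli_indep (R : comPzRingType) (T : finType) (p : R) (U : {set T})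
    (a b : pred {set T}) :
  (forall X Y : {set T}, X :&: U = Y :&: U -> a X = a Y) ->
  (forall X Y : {set T}, X :\: U = Y :\: U -> b X = b Y) ->
  \sum_(X | a X && b X) bernoulli_weight p X =
  (\sum_(X | a X) bernoulli_weight p X) * (\sum_(X | b X) bernoulli_weight p X).
Proof.
move=> ha hb; pose mix (X Y : {set T}) := (X :&: U) :|: (Y :\: U).
pose sw (P : {set T} * {set T}) := (mix P.1 P.2, mix P.2 P.1).
have swK : involutive sw.
  move=> [X Y]; congr (_, _); apply/setP => i; rewrite !inE /=;
  by case: (i \in X); case: (i \in Y); case: (i \in U).
have mixI X Y : mix X Y :&: U = X :&: U.
  by apply/setP => i; rewrite !inE; case: (i \in U); rewrite ?andbF ?andbT ?orbF.
have mixD X Y : mix X Y :\: U = Y :\: U.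
  by apply/setP => i; rewrite !inE; case: (i \in U); rewrite ?andbF ?andbT.
rewrite big_distrlr /= pair_big /=.
(* After the swap, [a] and [b] both test the first sample; the second is free and has total weight
   1, supplied on the left as a factor. *)
rewrite (reindex_inj (inv_inj swK)) /= -[LHS]mulr1 -(bernoulli_sum1 T p).
rewrite big_distrlr /= pair_big /=; apply: eq_big => [[X Y]|[X Y] _] /=.
  rewrite andbT; congr (_ && _); first by apply: ha; rewrite mixI.
  by apply: hb; rewrite mixD.
rewrite -!big_split /=; apply: eq_bigr => i _; rewrite !inE.
by case: (i \in U); rewrite ?andbT ?andbF ?orbF //= mulrC.
Qed.

(** * Greedy and dynamic colorings *)

Lemma greedy_coloring (T : finType) (e : rel T) (k : nat) (A : {set T}) :
  symmetric e -> irreflexive e -> (0 < k)%N ->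
  (forall u, u \in A -> #|[set w in A | e u w]| < k)%N ->
  exists c : {ffun T -> 'I_k}, {in A &, forall u w, e u w -> c u != c w}.
Proof.
move=> es ei k0; move: {2}#|A| (erefl #|A|) => m.
elim: m A => [|m IH] A hm hA.
  exists [ffun _ => Ordinal k0] => u w.
  by rewrite (cards0_eq hm) inE.
have /card_gt0P[u uA] : (0 < #|A|)%N by rewrite hm.
have [||c hc] := IH (A :\ u).
- by apply: succn_inj; rewrite -hm (cardsD1 u A) uA.
- move=> v; rewrite inE => /andP[_ vA]; apply: leq_ltn_trans (hA v vA).
  apply: subset_leq_card; apply/subsetP => w; rewrite !inE.
  by case/andP => /andP[_ ->] ->.
have [a ha|full] := pickP [pred a | a \notin c @: [set w in A | e u w]].
  exists [ffun v => if v == u then a else c v].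
  have fresh w : w \in A -> e u w -> c w != a.
    move=> wA uw; apply: contraNneq ha => <-; apply: imset_f.
    by rewrite inE wA uw.
  move=> v w vA wA vw; rewrite !ffunE.
  case: (eqVneq v u) => [vu|vu]; case: (eqVneq w u) => [wu|wu].
  - by rewrite vu wu ei in vw.
  - by rewrite eq_sym fresh // -vu.
  - by rewrite fresh // es -wu.
  - by apply: hc => //; rewrite !inE ?vu ?wu.
have : (k <= #|c @: [set w in A | e u w]|)%N.
  rewrite -{1}(card_ord k); apply: subset_leq_card; apply/subsetP => a _.
  by have := full a; rewrite /= => /negbFE.
by move/leq_trans/(_ (leq_imset_card _ _)); rewrite leqNgt hA.
Qed.

Lemma chromatic_number_colorable (G : sgraph) : colorable G (chromatic_number G).
Proof. by rewrite /chromatic_number; case: ex_minnP. Qed.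

Lemma dynamic_chromatic_number_le r (G : sgraph) k :
  dynamic_colorable r G k -> (dynamic_chromatic_number r G <= k)%N.
Proof. by move=> hk; rewrite /dynamic_chromatic_number; case: ex_minnP => m _; apply. Qed.

Lemma dynamic2P (G : sgraph) k (c : {ffun G -> 'I_k}) :
  (forall v w, adj v w -> c v != c w) ->
  (forall v, (1 < deg v)%N -> exists a b, [/\ adj v a, adj v b & c a != c b]) ->
  dynamic_colorable 2 G k.
Proof.
move=> cP c2; apply/existsP; exists c; apply/andP; split.
  by apply/forallP => v; apply/forallP => w; apply/implyP; apply: cP.
apply/forallP => v; case: (ltnP 1 (deg v)) => hv.
  have [a [b [va vb ab]]] := c2 v hv.
  apply: leq_trans (geq_minl _ _) _.
  have <- : #|[set c a; c b]| = 2%N by rewrite cards2 ab.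
  apply: subset_leq_card; apply/subsetP => z; rewrite !inE.
  by case/orP => /eqP ->; apply: imset_f; rewrite inE.
apply: leq_trans (geq_minr _ _) _.
have [->//|/card_gt0P[a va]] := posnP (deg v).
apply: leq_trans hv _; apply/card_gt0P; exists (c a); exact: imset_f.
Qed.

Lemma colorable_dynamic_deg1 (G : sgraph) k :
  (forall v : G, deg v <= 1)%N -> colorable G k -> dynamic_colorable 2 G k.
Proof.
move=> h1 /existsP[c /forallP cP]; apply: (@dynamic2P _ _ c) => [v w vw|v].
  by have /forallP/(_ w)/implyP := cP v; apply.
by rewrite ltnNge h1.
Qed.

Lemma regular_colorable_ge2 (G : sgraph) d k (v : G) :
  regular_graph d G -> (0 < d)%N -> colorable G k -> (2 <= k)%N.
Proof.
move=> hG d0 /existsP[c /forallP cP].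
have /card_gt0P[w] : (0 < #|nbh v|)%N by rewrite -/(deg v) hG.
rewrite inE => vw; have /forallP/(_ w)/implyP/(_ vw) := cP v.
by case: k c {cP} => [|[|k]] // c; [case: (c v)|rewrite (ord1 (c v)) (ord1 (c w))].
Qed.

(* Joining, for every vertex, two chosen neighbours by an extra edge gives
   a graph of maximum degree at most [2 * d]. *)
Lemma regular_dynamic_greedy (G : sgraph) d :
  regular_graph d G -> (1 < d)%N -> dynamic_colorable 2 G (2 * d).+1.
Proof.
move=> hG d2.
have pair v : exists ab : G * G, [&& adj v ab.1, adj v ab.2 & ab.1 != ab.2].
  have : (1 < #|nbh v|)%N by rewrite -/(deg v) hG.
  case/card_gt1P => a [b [va vb ab]]; exists (a, b) => /=.
  by move: va vb; rewrite !inE => -> ->.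
pose ab v := xchoose (pair v).
have abP v : [&& adj v (ab v).1, adj v (ab v).2 & (ab v).1 != (ab v).2].
  exact: (xchooseP (pair v)).
pose ee u w := [exists v, ((u, w) == ab v) || ((w, u) == ab v)].
pose e u w := adj u w || ee u w.
have [||||c hc] := @greedy_coloring _ e (2 * d).+1 [set: G].
- move=> u w; rewrite /e adj_sym; congr (_ || _).
  by apply/existsP/existsP => -[v hv]; exists v; rewrite orbC.
- move=> u; rewrite /e adj_irr; apply/existsP => -[v].
  by rewrite orbb => /eqP uu; have := abP v; rewrite -uu /= eqxx !andbF.
- by [].
- move=> u _; rewrite ltnS.
  (* Each extra edge at [u] was chosen by a neighbour [v] of [u], and [other v] is its other end, so
     there are at most [d] of them. When [u] is not in the pair of [v], the value is arbitrary,
     which is harmless in an upper bound. *)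
  pose other v := if (ab v).1 == u then (ab v).2 else (ab v).1.
  apply: leq_trans (_ : #|nbh u :|: (other @: nbh u)| <= _)%N.
    apply: subset_leq_card; apply/subsetP => w; rewrite !inE /=.
    case/orP => [->//|/existsP[v hv]]; apply/orP; right.
    have /and3P[v1 v2 v12] := abP v; apply/imsetP; exists v.
      by rewrite inE adj_sym; case/orP: hv => /eqP hv; [move: v1|move: v2]; rewrite -hv.
    rewrite /other; case/orP: hv => /eqP hv; rewrite -hv ?eqxx //=.
    by move: v12; rewrite -hv /= => /negbTE ->.
  rewrite mul2n -addnn; apply: leq_trans (leq_card_setU _ _) _.
  have hu : #|nbh u| = d := hG u.
  by rewrite leq_add ?hu //; apply: leq_trans (leq_imset_card _ _) _; rewrite hu.
apply: (@dynamic2P _ _ c) => [v w vw|v _]; first by apply: hc; rewrite ?inE // /e vw.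
have /and3P[v1 v2 v12] := abP v; exists (ab v).1, (ab v).2; split => //.
apply: hc; rewrite ?inE //; apply/orP; right; apply/existsP; exists v.
by rewrite -surjective_pairing eqxx.
Qed.

Lemma recolor_dynamic (G : sgraph) m k (X : {set G}) :
  (0 < k)%N -> colorable G m ->
  (forall v, exists2 a, adj v a & a \in X) ->
  (forall v, exists2 b, adj v b & b \notin X) ->
  (forall v, v \in X -> #|nbh v :&: X| < k)%N ->
  dynamic_colorable 2 G (m + k).
Proof.
move=> k0 /existsP[c /forallP cP] hin hout hdeg.
have [|g hg] := @greedy_coloring _ (@adj G) k X (@adj_sym G) (@adj_irr G) k0.
  move=> u uX; apply: leq_ltn_trans (hdeg u uX); rewrite leq_eqVlt; apply/orP; left.
  by apply/eqP; apply: eq_card => w; rewrite !inE andbC.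
pose f : {ffun G -> 'I_(m + k)} :=
  [ffun v => if v \in X then rshift m (g v) else lshift k (c v)].
apply: (@dynamic2P _ _ f) => [v w vw|v _]; last first.
  have [a va aX] := hin v; have [b vb bX] := hout v; exists a, b; split=> //.
  by rewrite !ffunE aX (negbTE bX) eq_rlshift.
rewrite !ffunE; case: ifPn => vX; case: ifPn => wX.
- by rewrite eq_rshift; apply: hg.
- by rewrite eq_rlshift.
- by rewrite eq_lrshift.
- by rewrite eq_lshift; have /forallP/(_ w)/implyP := cP v; apply.
Qed.

(** * Bad events for a random vertex set *)

Definition cnbh (G : sgraph) (v : G) : {set G} := v |: nbh v.

(** Such a [u] lies in [cnbh w] for some neighbour [w] of [v]; if the common vertex is [v] itself,
    take [w = u]. Without [v], each of these [d] sets has [d] elements. *)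
Lemma card_cnbh_meet (G : sgraph) d (v : G) : regular_graph d G ->
  (#|[set u | cnbh u :&: cnbh v != set0] :\ v| <= d ^ 2)%N.
Proof.
move=> hG; apply: leq_trans (_ : #|\bigcup_(w in nbh v) (cnbh w :\ v)| <= _)%N.
  apply: subset_leq_card; apply/subsetP => u; rewrite !inE.
  case/andP => uv /set0Pn[w]; rewrite !inE => /andP[h1 h2].
  case/orP: h2 => [/eqP wv|vw].
    move: h1; rewrite wv eq_sym (negbTE uv) /= => uv'.
    by apply/bigcupP; exists u; rewrite ?inE ?eqxx ?uv // adj_sym.
  apply/bigcupP; exists w; first by rewrite inE.
  rewrite !inE uv /=; case/orP: h1 => [/eqP ->|]; first by rewrite eqxx.
  by rewrite (adj_sym u) orbC => ->.
apply: leq_trans (_ : \sum_(w in nbh v) d <= _)%N; last first.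
  by rewrite sum_nat_const -/(deg v) hG mulnn.
elim/big_rec2: _ => [|w n B wv IH]; first by rewrite cards0.
apply: leq_trans (leq_card_setU _ _) _; rewrite leq_add //.
rewrite inE in wv.
have := cardsD1 v (cnbh w); rewrite {1}/cnbh cardsU1 !inE adj_irr -/(deg w) hG.
by rewrite (adj_sym w) wv orbT /= !add1n => -[<-].
Qed.

Lemma regular_local_lemma (R : realDomainType) (G : sgraph) d (p x q : R)
    (A : G -> pred {set G}) :
  regular_graph d G -> 0 <= p <= 1 -> 0 <= x < 1 -> q <= x * (1 - x) ^+ (d ^ 2) ->
  (forall v X Y, X :&: cnbh v = Y :&: cnbh v -> A v X = A v Y) ->
  (forall v, \sum_(X | A v X) bernoulli_weight p X <= q) ->
  exists X, forall v, ~~ A v X.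
Proof.
move=> hG /andP[p0 p1] hx hq hA hAq.
have w0 (X : {set G}) : 0 <= bernoulli_weight p X.
  by apply: prodr_ge0 => i _; case: ifP; rewrite ?subr_ge0.
apply: (@lopsided_local_lemma _ _ _ (bernoulli_weight p) A
  (fun v => [set u | cnbh u :&: cnbh v != set0]) (d ^ 2) x q) => //.
- by rewrite bernoulli_sum1 ltr01.
- by move=> v; apply: card_cnbh_meet.
(* The event at [v] is decided inside [cnbh v], those of [S] outside it. *)
move=> v S vS disj; rewrite (@bernoulli_indep _ _ _ (cnbh v)).
- by rewrite ler_wpM2r // sumr_ge0.
- exact: hA.
move=> X Y XY; apply: eq_forallb_in => u uS; congr (~~ _); apply: hA.
have := disjointFr disj uS; rewrite inE => /negbFE/eqP uv0.
have sub : cnbh u \subset ~: cnbh v by rewrite -disjoints_subset -setI_eq0 uv0.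
rewrite -(setIidPr sub) !setIA; congr (_ :&: _).
by rewrite -!setDE.
Qed.

Lemma prod_if_const (R : comPzRingType) (T : finType) (N : {set T}) (a : R) :
  \prod_i (if i \in N then a else 1) = a ^+ #|N|.
Proof. by rewrite -big_mkcond /= prodr_const. Qed.

Definition unbalanced (G : sgraph) (k : nat) (v : G) (X : {set G}) : bool :=
  [|| [disjoint nbh v & X], nbh v \subset X | (v \in X) && (k <= #|nbh v :&: X|)%N].

Lemma unbalanced_local (G : sgraph) k (v : G) (X Y : {set G}) :
  X :&: cnbh v = Y :&: cnbh v -> unbalanced k v X = unbalanced k v Y.
Proof.
move=> XY; have vXY w : w \in cnbh v -> (w \in X) = (w \in Y).
  by move=> wv; move/setP/(_ w): XY; rewrite !inE in wv *; rewrite wv !andbT.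
have NXY : nbh v :&: X = nbh v :&: Y.
  apply/setP => w; rewrite !(in_setI, in_setU); case wv: (w \in nbh v) => //=.
  by apply: vXY; rewrite in_setU wv orbT.
rewrite /unbalanced -!setI_eq0 !(sameP setIidPl eqP) NXY vXY //.
by rewrite in_setU1 eqxx.
Qed.

(* The third term comes from Markov's inequality for [t ^+ #|nbh v :&: X|]. *)
Lemma unbalanced_prob (R : realFieldType) (G : sgraph) (k : nat) (v : G) (p t : R) :
  0 <= p <= 1 -> 1 <= t ->
  \sum_(X | unbalanced k v X) bernoulli_weight p X <=
  (1 - p) ^+ deg v + p ^+ deg v + p * (1 + p * (t - 1)) ^+ deg v / t ^+ k.
Proof.
move=> /andP[p0 p1] t1; have t0 : 0 < t by apply: lt_le_trans t1.
pose N := nbh v; have vN : v \notin N by rewrite inE adj_irr.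
(* [E1] and [E2] are the indicators of the first two clauses; [E3] is the indicator of [v \in X]
   times [t ^+ #|N :&: X|]. As products over vertices, they have computable expectations. *)
pose E1 (X : {set G}) : R := \prod_i (if i \in X then (i \notin N)%:R else 1).
pose E2 (X : {set G}) : R := \prod_i (if i \in X then 1 else (i \notin N)%:R).
pose E3 (X : {set G}) : R :=
  \prod_i (if i \in X then (if i \in N then t else 1) else (i != v)%:R).
have e1 : \sum_X bernoulli_weight p X * E1 X = (1 - p) ^+ deg v.
  rewrite bernoulli_sum_prod -prod_if_const; apply: eq_bigr => i _.
  by case: (i \in N) => /=; ring.
have e2 : \sum_X bernoulli_weight p X * E2 X = p ^+ deg v.
  rewrite bernoulli_sum_prod -prod_if_const; apply: eq_bigr => i _.
  by case: (i \in N) => /=; ring.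
have e3 : \sum_X bernoulli_weight p X * E3 X = p * (1 + p * (t - 1)) ^+ deg v.
  rewrite bernoulli_sum_prod -prod_if_const (bigD1 v) //= [in RHS](bigD1 v) //=.
  rewrite (negbTE vN) eqxx mulr0 addr0 mulr1 mul1r; congr (_ * _).
  apply: eq_bigr => i iv; rewrite iv; case: (i \in N) => /=; ring.
have E1_ge0 X : 0 <= E1 X by apply: prodr_ge0 => i _; case: ifP.
have E2_ge0 X : 0 <= E2 X by apply: prodr_ge0 => i _; case: ifP.
have E3_ge0 X : 0 <= E3 X.
  by apply: prodr_ge0 => i _; case: ifP => // _; case: ifP => // _; apply: ltW.
have tk0 : 0 < t ^+ k by rewrite exprn_gt0.
rewrite -e1 -e2 -e3 mulr_suml -!big_split /= big_mkcond /=.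
apply: ler_sum => X _.
have w0 : 0 <= bernoulli_weight p X.
  by apply: prodr_ge0 => i _; case: ifP; rewrite ?subr_ge0.
rewrite -!mulrA -!mulrDr; have ge0 : 0 <= E1 X + E2 X + E3 X / t ^+ k.
  by rewrite !addr_ge0 // divr_ge0 // ltW.
case: ifP => [bad|_]; last by rewrite mulr_ge0.
rewrite -[leLHS]mulr1 ler_wpM2l //.
have E3k : 0 <= E3 X / t ^+ k by rewrite divr_ge0 // ltW.
case/or3P: bad => [dis|sub|/andP[vX hk]].
- suff -> : E1 X = 1 by have := E2_ge0 X; lra.
  apply: big1 => i _; case: ifP => // iX.
  by rewrite (disjointFl dis).
- suff -> : E2 X = 1 by have := E1_ge0 X; lra.
  apply: big1 => i _; case: ifPn => // iX.
  by rewrite (contra (subsetP sub i)).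
suff : 1 <= E3 X / t ^+ k by have := E1_ge0 X; have := E2_ge0 X; lra.
suff -> : E3 X = t ^+ #|N :&: X| by rewrite ler_pdivlMr // mul1r ler_weXn2l.
rewrite -prod_if_const; apply: eq_bigr => i _; rewrite in_setI.
case iX: (i \in X); first by rewrite andbT.
have -> : i != v by apply: contraFneq iX => ->.
by rewrite andbF.
Qed.

(** * Numerical estimates *)

Lemma exprDn_le_expR (R : realType) (n : nat) (x : R) : (0 < n)%N ->
  0 <= 1 + x / n%:R -> (1 + x / n%:R) ^+ n <= expR x.
Proof.
move=> n0 hx; rewrite -[in leRHS](divfK (_ : n%:R != 0) x) ?pnatr_eq0 -?lt0n //.
by rewrite expRM_natr; apply: lerXn2r; rewrite ?nnegrE ?expR_ge0 ?expR_ge1Dx.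
Qed.

Lemma expR1_gt (R : realType) : 271 / 100 < expR 1 :> R.
Proof.
apply: lt_le_trans (@exprDn_le_expR R 512 1 isT _); lra.
Qed.

(* Bounding ln 65 below by 25/6 requires e < 65^(6/25), about 2.7233. *)
Lemma expR1_lt (R : realType) : expR 1 < 2723 / 1000 :> R.
Proof.
have h : 1000 / 2723 < expR (-1) :> R.
  (* The relative error of (1 - 1/n)^n is about 1/(2n), and about 0.0017 is allowed; 256 would be
     too small. *)
  apply: lt_le_trans (@exprDn_le_expR R 512 (-1) isT _); lra.
have := expRxMexpNx_1 (1 : R); have := expR_gt0 (1 : R); nra.
Qed.

(** Reduces bounds on logarithms to rational arithmetic, through e^a <= 2.723^a <= x^b. *)
Lemma ln_ge_frac (R : realType) (a b : nat) (x : R) : (0 < b)%N -> 0 < x ->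
  (2723 / 1000) ^+ a <= x ^+ b -> a%:R / b%:R <= ln x.
Proof.
move=> b0 x0 h; rewrite ler_pdivrMr ?ltr0n // mulr_natr -lnXn //.
rewrite -(expRK a%:R) ler_ln ?posrE ?expR_gt0 ?exprn_gt0 //.
apply: le_trans h; rewrite -[a%:R]mulr1 expRM_natl; apply: lerXn2r.
- by rewrite nnegrE expR_ge0.
- by rewrite nnegrE; lra.
- exact/ltW/expR1_lt.
Qed.

(** The extra [p ^+ 2 / 4] makes room for the other failure terms. Squaring 1 - p/2 <= exp(-p/2)
    gives 1 - p <= exp(-p) - p^2/4 <= exp(-p) (1 - p^2/4). *)
Lemma onem_le_expR (R : realType) (p : R) : 0 <= p <= 2 ->
  1 - p <= expR (- p - p ^+ 2 / 4).
Proof.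
move=> /andP[p0 p2].
have h1 : (1 - p / 2) ^+ 2 <= expR (- p).
  rewrite (_ : - p = 2%:R * (- (p / 2))); last by field.
  rewrite expRM_natl; apply: lerXn2r; rewrite ?nnegrE ?expR_ge0 ?expR_ge1Dx //; lra.
rewrite expRD; have h2 := expR_ge1Dx (- (p ^+ 2 / 4)).
have e0 := expR_ge0 (- p); have e1 : expR (- p) <= 1 by rewrite expR_le1; lra.
apply: le_trans (ler_wpM2l e0 h2).
have : p ^+ 2 / 4 * expR (- p) <= p ^+ 2 / 4 by rewrite ler_piMr // divr_ge0 ?sqr_ge0.
nra.
Qed.

(** With m = dp >= 6, the quadratic gain m p/4 is at least 3p/2, and exp(-3p/2) <= 1 - p - p/50.
    This leaves exp(-m) p for the third term and exp(-m) p/50 for [p ^+ d], which is exp(-m) (p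
    exp(p))^d with p exp(p) <= 0.6. *)
Lemma failure_sum_le (R : realType) (d : nat) (p : R) :
  (14 < d)%N -> 0 <= p -> p * expR 1 <= 1 -> 6 <= d%:R * p ->
  (1 - p) ^+ d + p ^+ d + p * expR (- (d%:R * p)) <= expR (- (d%:R * p)).
Proof.
move=> d14 p0 pe m6; set m := d%:R * p in m6 *.
have egt := expR1_gt R; have elt := expR1_lt R.
have p37 : p <= 37 / 100 by nra.
have h1 : (1 - p) ^+ d <= expR (- m) * expR (- (3 / 2 * p)).
  rewrite -expRD; apply: le_trans (_ : expR (- p - p ^+ 2 / 4) ^+ d <= _).
    by apply: lerXn2r; rewrite ?nnegrE ?expR_ge0 ?onem_le_expR //; lra.
  rewrite -expRM_natl ler_expR.
  have -> : d%:R * (- p - p ^+ 2 / 4) = - m - m * (p / 4) by rewrite /m; ring.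
  nra.
have ep : expR p <= 8 / 5.
  have := expRxMexpNx_1 p; have := expR_ge1Dx (- p); have := expR_ge0 p; nra.
have pep : p * expR p <= 6 / 10 by have := expR_ge0 p; nra.
have h2 : p ^+ d <= expR (- m) * (p / 50).
  rewrite expRN ler_pdivlMl ?expR_gt0 // /m expRM_natl -exprMn.
  have r0 : 0 <= expR p * p by rewrite mulr_ge0 ?expR_ge0.
  rewrite -(subnKC d14) (exprD _ 15) (exprS _ 14) -mulrA.
  have r14 : (expR p * p) ^+ 14 <= (6 / 10) ^+ 14.
    by apply: lerXn2r; rewrite ?nnegrE // mulrC //; lra.
  have rd : (expR p * p) ^+ (d - 15) <= 1 by rewrite exprn_ile1 //; lra.
  have : (expR p * p) ^+ 14 * (expR p * p) ^+ (d - 15) <= (6 / 10) ^+ 14.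
    by apply: le_trans r14; rewrite ler_piMr ?exprn_ge0.
  move/(ler_wpM2l r0)/le_trans; apply.
  have : (6 / 10 : R) ^+ 14 <= 1 / 100 by lra.
  move/(ler_wpM2l r0)/le_trans; apply; nra.
have h3 : expR (- (3 / 2 * p)) <= 1 - p - p / 50.
  have h : (1 + 3 / 4 * p) ^+ 2 <= expR (3 / 2 * p).
    rewrite (_ : 3 / 2 * p = 2%:R * (3 / 4 * p)); last by field.
    rewrite expRM_natl; apply: lerXn2r;
      by rewrite ?nnegrE ?expR_ge0 ?expR_ge1Dx //; lra.
  rewrite expRN -[leLHS]mulr1 ler_pdivrMl ?expR_gt0 //.
  apply: le_trans (ler_wpM2r _ h); nra.
have e0 := expR_ge0 (- m).
have := ler_wpM2l e0 h3; nra.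
Qed.

Lemma small_degree_bound (R : realType) (d : nat) : (1 < d < 9)%N ->
  (2 * d - 2)%:R < expR 1 * ln (d%:R ^+ 2 + 1) + expR 1 :> R.
Proof.
case/andP=> d1 d9; have egt := expR1_gt R.
have key (a b c : nat) : (0 < b)%N ->
    (2723 / 1000 : R) ^+ a <= (d%:R ^+ 2 + 1) ^+ b ->
    c%:R < 271 / 100 * (a%:R / b%:R + 1) :> R ->
    c%:R < expR 1 * ln (d%:R ^+ 2 + 1) + expR 1 :> R.
  move=> b0 hab /lt_le_trans; apply.
  have := ln_ge_frac b0 _ hab; rewrite ltr_pwDr ?sqr_ge0 // => /(_ isT).
  have : 0 <= a%:R / b%:R :> R by rewrite divr_ge0.
  nra.
case: d d1 d9 key => [|[|[|[|[|[|[|[|[|//]]]]]]]]] // _ _ key.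
(* For d = 2, ..., 8: a/b is a lower bound for ln(d^2 + 1) and c = 2d - 2. The case d = 8 is tight:
   2.71 (25/6 + 1) barely exceeds 14. *)
- by apply: (key 1%N 1%N 2%N) => //=; lra.
- by apply: (key 1%N 1%N 4%N) => //=; lra.
- by apply: (key 2%N 1%N 6%N) => //=; lra.
- by apply: (key 2%N 1%N 8%N) => //=; lra.
- by apply: (key 3%N 1%N 10%N) => //=; lra.
- by apply: (key 7%N 2%N 12%N) => //=; lra.
- by apply: (key 25%N 6%N 14%N) => //=; lra.
Qed.

(** For d >= 9, passing to d + 1 multiplies the first factor by at most 9/16 and d^2 + 1 by at most
    16/9, so only d = 9 is computed. The constant 0.36 is below 1/e. *)
Lemma half_density_bound (R : realFieldType) (d : nat) : (8 < d)%N ->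
  (2 * (1 / 2) ^+ d + 1 / 16 * (9 / 16) ^+ d) * (d%:R ^+ 2 + 1) <= 36 / 100 :> R.
Proof.
elim: d => // d IH; rewrite ltnS leq_eqVlt => /orP[/eqP <-|d9].
  by rewrite !exprS !expr0; lra.
apply: le_trans (IH d9); rewrite -(natr1 d) !exprS.
have : 9 <= d%:R :> R by rewrite (ler_nat R 9).
move: (d%:R : R) => y y9; rewrite !expr0 mulr1.
have a0 : 0 <= (1 / 2 : R) ^+ d by rewrite exprn_ge0 //; lra.
have b0 : 0 <= (9 / 16 : R) ^+ d by rewrite exprn_ge0 //; lra.
set a := (1 / 2) ^+ d in a0 *; set b := (9 / 16) ^+ d in b0 *.
have hy : 9 / 16 * ((y + 1) * (y + 1) + 1) <= y * y + 1 by nra.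
apply: le_trans (_ : (2 * a + 1 / 16 * b) * (9 / 16 * ((y + 1) * (y + 1) + 1)) <= _).
  rewrite [leRHS]mulrA; apply: ler_wpM2r; nra.
by apply: ler_wpM2l => //; lra.
Qed.

(** The symmetric condition e q (n + 1) <= 1, with x = 1/(n + 1): here 1 - x = 1/(1 + 1/n) >=
    exp(-1/n). *)
Lemma local_lemma_threshold (R : realType) (n : nat) :
  expR (- 1) / (n%:R + 1) <= (n%:R + 1)^-1 * (1 - (n%:R + 1)^-1) ^+ n :> R.
Proof.
have n1 : 0 < n%:R + 1 :> R by rewrite ltr_wpDl.
rewrite mulrC ler_pM2l ?invr_gt0 //; have [->|n0] := posnP n.
  by rewrite expr0 expR_le1; lra.
have nR : 0 < n%:R :> R by rewrite ltr0n.
rewrite (_ : -1 = n%:R * - n%:R^-1); last by rewrite mulrN mulfV ?gt_eqF.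
rewrite expRM_natl; apply: lerXn2r; rewrite ?nnegrE ?expR_ge0 //.
  by rewrite subr_ge0 invf_le1 // lerDr ltW.
rewrite expRN (_ : 1 - _ = (1 + n%:R^-1)^-1); last first.
  by field; rewrite ?gt_eqF //= ?addr_gt0.
by rewrite lef_pV2 ?posrE ?expR_gt0 ?expR_ge1Dx // addr_gt0 ?invr_gt0.
Qed.

(** * Choice of the density and conclusion *)

Lemma exists_balanced_set (R : realType) (G : sgraph) d k : regular_graph d G ->
  (8 < d)%N -> expR 1 * ln (d%:R ^+ 2 + 1) + expR 1 <= k%:R :> R ->
  exists X : {set G}, forall v, ~~ unbalanced k v X.
Proof.
move=> hG d9 hk; have egt := expR1_gt R; have elt := expR1_lt R.
have e0 : 0 < expR 1 :> R := expR_gt0 1.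
have dR : 9 <= d%:R :> R by rewrite (ler_nat R 9).
have s0 : 0 < d%:R ^+ 2 + 1 :> R by rewrite ltr_pwDr ?sqr_ge0.
suff [p p01 hp] : exists2 p : R, 0 <= p <= 1 & forall v : G,
    \sum_(X | unbalanced k v X) bernoulli_weight p X
      <= expR (- 1) / (d%:R ^+ 2 + 1).
  apply: (@regular_local_lemma R G d p ((d ^ 2)%:R + 1)^-1
            (expR (- 1) / (d%:R ^+ 2 + 1))) => //.
  - rewrite natrX invr_ge0 ltW //= invf_lt1 // ltrDr.
    by rewrite exprn_gt0 // ltr0n (ltn_trans _ d9).
  - by rewrite -natrX; apply: local_lemma_threshold.
  - exact: unbalanced_local.
have [kd|dk] := leqP k d; last first.
  (* With t = 8 and k >= d + 1, the third term is at most (1/2) (9/2)^d / 8^(d+1) = (1/16)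
     (9/16)^d. *)
  exists (1 / 2) => [|v]; first lra.
  apply: le_trans (@unbalanced_prob R G k v (1 / 2) 8 _ _) _; try lra.
  rewrite ler_pdivlMr // hG.
  have h36 : 36 / 100 <= expR (- 1) :> R.
    rewrite expRN -[leLHS]invrK lef_pV2 ?posrE ?invr_gt0 //; lra.
  apply: le_trans h36; apply: le_trans (half_density_bound R d9).
  apply: ler_wpM2r; first exact: ltW.
  have -> : 1 - 1 / 2 = 1 / 2 :> R by field.
  rewrite (_ : _ + (1 / 2) ^+ d = 2 * (1 / 2) ^+ d); last by ring.
  have -> : 1 + 1 / 2 * (8 - 1) = 9 / 2 :> R by field.
  rewrite lerD2l.
  apply: le_trans (_ : 1 / 2 * (9 / 2) ^+ d / 8 ^+ d.+1 <= _).
    apply: ler_wpM2l; first by rewrite mulr_ge0 ?exprn_ge0 //; lra.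
    by rewrite lef_pV2 ?posrE ?exprn_gt0 // ler_weXn2l // ler1n.
  rewrite le_eqVlt; apply/orP; left; apply/eqP.
  rewrite (_ : 9 / 16 = 9 / 2 / 8 :> R); last by field.
  by rewrite (expr_div_n (9 / 2) 8 d) exprS invfM; field; rewrite expf_neq0.
have ln_ge y (a b : nat) : (0 < b)%N -> 0 < y -> y <= d%:R ^+ 2 + 1 ->
    (2723 / 1000 : R) ^+ a <= y ^+ b ->
    a%:R / b%:R <= ln (d%:R ^+ 2 + 1) :> R.
  move=> b0 y0 yd /(ln_ge_frac b0 y0)/le_trans; apply.
  by rewrite ler_ln ?posrE.
(* Bootstrapping: d >= 9 gives k >= 15, hence d >= 15, hence ln(d^2 + 1) >= 5 and a mean of at least
   6, as [failure_sum_le] requires. *)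
have k15 : (14 < k)%N.
  have : 13 / 3 <= ln (d%:R ^+ 2 + 1) :> R.
    by apply: (ln_ge 82 13%N 3%N) => //; [nra|lra].
  move=> h; rewrite -(ltr_nat R); nra.
have d15 : (14 < d)%N := leq_trans k15 kd.
have d15R : 15 <= d%:R :> R by rewrite (ler_nat R 15).
have ln5 : 5 / 1 <= ln (d%:R ^+ 2 + 1) :> R.
  by apply: (ln_ge 226 5%N 1%N) => //; [nra|lra].
pose p : R := k%:R / (expR 1 * d%:R).
have d0 : 0 < d%:R :> R by lra.
have dp : d%:R * p = k%:R / expR 1 by rewrite /p; field; rewrite !gt_eqF.
have pe : p * expR 1 <= 1.
  rewrite (_ : p * expR 1 = k%:R / d%:R); last by rewrite /p; field; rewrite !gt_eqF.
  by rewrite ler_pdivrMr // mul1r ler_nat.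
have p0 : 0 <= p by rewrite divr_ge0 // mulr_ge0 // ltW.
have p1 : p <= 1 by nra.
have hm : ln (d%:R ^+ 2 + 1) + 1 <= d%:R * p.
  by rewrite dp ler_pdivlMr //; apply: le_trans hk; lra.
exists p => [|v]; first by rewrite p0.
apply: le_trans (@unbalanced_prob R G k v p (expR 1) _ _) _; rewrite ?p0 //; first lra.
rewrite hG; apply: le_trans (_ : expR (- (d%:R * p)) <= _); last first.
  rewrite -[d%:R ^+ 2 + 1]lnK ?posrE // -expRB ler_expR; lra.
apply: le_trans (failure_sum_le d15 p0 pe _); last lra.
rewrite lerD2l -mulrA; apply: ler_wpM2l => //.
(* Since k is e times the mean m, taking t = e gives the tail exponent (e - 1) m - e m = -m. *)
have ek : expR 1 ^+ k = expR (expR 1 * (d%:R * p)).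
  by rewrite dp mulrC divfK ?gt_eqF // -expRM_natl mulr1.
rewrite ek ler_pdivrMr ?expR_gt0 // -expRD.
apply: le_trans (_ : expR (p * (expR 1 - 1)) ^+ d <= _).
  apply: lerXn2r; rewrite ?nnegrE ?expR_ge0 ?expR_ge1Dx //; nra.
by rewrite -expRM_natl ler_expR; lra.
Qed.

Theorem theorem1 (R : realType) (d : nat) (G : sgraph) (hG : regular_graph d G) :
  (dynamic_chromatic_number 2 G)%:Z <=
  (chromatic_number G)%:Z +
  Num.ceil (expR 1 * ln (d%:R ^+ 2 + 1) + expR 1 : R).
Proof.
set s : R := _ + _.
have s0 : 0 < s.
  by rewrite ltr_wpDl ?expR_gt0 // mulr_ge0 ?expR_ge0 // ln_ge0 // lerDr sqr_ge0.
have ceil0 : 0 <= Num.ceil s by rewrite ceil_ge0; lra.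
have := ceil_ge s; case: (Num.ceil s) ceil0 => // k _.
rewrite -PoszD lez_nat -pmulrn => hk.
have k0 : (0 < k)%N by rewrite -(ltr_nat R); lra.
have chiP := chromatic_number_colorable G.
have [v _|G0] := pickP (xpredT : pred G); last first.
  apply: leq_trans (dynamic_chromatic_number_le (dynamic_colorable_card 2 G)) _.
  by rewrite (eq_card0 G0).
have [d1|d2] := leqP d 1.
  apply: leq_trans (leq_addr _ _); apply: dynamic_chromatic_number_le.
  by apply: colorable_dynamic_deg1 => // u; rewrite hG.
have [d8|d9] := ltnP d 9.
  apply: leq_trans (dynamic_chromatic_number_le (regular_dynamic_greedy hG d2)) _.
  have := regular_colorable_ge2 v hG (ltnW d2) chiP.
  (* By integrality k >= 2d - 1, and an edge forces at least 2 old colors, so 2d + 1 colors are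
     within the bound. *)
  have : (2 * d - 2 < k)%N.
    rewrite -(ltr_nat R); apply: lt_le_trans hk.
    by apply: small_degree_bound; rewrite d2.
  lia.
have [X hX] := exists_balanced_set hG d9 hk.
apply: dynamic_chromatic_number_le; apply: (@recolor_dynamic _ _ _ X) => // u.
- have := hX u; rewrite !negb_or => /and3P[/pred0Pn[a /andP[]]].
  by rewrite /= inE => ua aX _ _; exists a.
- have := hX u; rewrite !negb_or => /and3P[_ /subsetPn[b]].
  by rewrite inE => ub bX _; exists b.
by move=> uX; have := hX u; rewrite !negb_or uX /= -ltnNge => /and3P[].
Qed.
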